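(* Let $(\mathbb{F},\sigma)$ be a difference field, $(\mathbb{F}(t),\sigma)$ a $\Pi\Sigma$-extension, $A\in\mathbb{F}(t)[\sigma]^{m\times n}$ and $b\in\mathbb{F}(t)^m$. Then there exist an integer $r$ (the rank of $A$), unimodular matrices $P\in\mathrm{GL}_m(\mathbb{F}(t)[\sigma,\sigma^{-1}])$ and $Q\in\mathrm{GL}_n(\mathbb{F}(t)[\sigma])$, and $\hat A\in\mathbb{F}(t)[\sigma]^{r\times r}$ such that $$PAQ=\begin{pmatrix}\hat A&0\\0&0\end{pmatrix},$$ and, writing $P(b)=\binom{b_1}{b_2}$ with $b_1\in\mathbb{F}(t)^r$, $b_2\in\mathbb{F}(t)^{m-r}$, the following hold: (i) $y\in\mathbb{F}(t)^n$ solves $A(y)=b$ if and only if $b_2=0$ and $Q^{-1}(y)=\binom{y_1}{y_2}$ with $y_1\in\mathbb{F}(t)^r$ satisfying $\hat A(y_1)=b_1$ and $y_2\in\mathbb{F}(t)^{n-r}$ arbitrary; (ii) there is $c\in\mathbb{F}[t]\setminus\{0\}$ such that $c\hat A$ has coefficient matrices in $\mathbb{F}[t]^{r\times r}$, $cb_1\in\mathbb{F}[t]^r$, and the system $(c\hat A)(y_1)=cb_1$ is fully regular. In particular every system of the form $A_\ell\sigma^\ell(y)+\dots+A_0y=b$ can be transformed into a related fully regular system, subject to the compatibility condition $b_2=0$.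
   Context: A difference field $(\mathbb{F},\sigma)$ is a field (containing $\mathbb{Q}$) with an automorphism $\sigma$; in a $\Pi\Sigma$-extension $(\mathbb{F}(t),\sigma)$, $\sigma$ extends to the rational function field with $\sigma(t)=t+\beta$ or $\sigma(t)=\alpha t$ ($\alpha,\beta\in\mathbb{F}\setminus\{0\}$) and no new constants. $\mathbb{F}(t)[\sigma]$ is the Ore polynomial ring: polynomials $\sum a_i\sigma^i$, $a_i\in\mathbb{F}(t)$, with multiplication determined by $\sigma a=\sigma(a)\sigma$; $\mathbb{F}(t)[\sigma,\sigma^{-1}]$ is its localisation at the powers of $\sigma$. An operator $\sum a_i\sigma^i$ acts on $\alpha\in\mathbb{F}(t)$ by $\sum a_i\sigma^i(\alpha)$; an operator matrix $L=(L_{ij})$ acts on a vector $\alpha$ by $L(\alpha)=(\sum_jL_{ij}(\alpha_j))_i$. A square matrix is unimodular if it has a two-sided inverse over the same ring. The rank of $A$ is the row rank of $A$ over $\mathbb{F}(t)[\sigma]$. A square system $\hat A(y)=\hat b$ with $\hat A=\sum_{i=0}^{\ell}\hat A_i\sigma^i$, $\hat A_i\in\mathbb{F}[t]^{r\times r}$, is head regular if $\det\hat A_\ell\ne0$, tail regular if $\det\hat A_0\ne0$, and fully regular if it is head regular and there exists $W\in\mathrm{GL}_r(\mathbb{F}(t)[\sigma,\sigma^{-1}])$ with $W\hat A\in\mathbb{F}(t)[\sigma]^{r\times r}$ such that $(W\hat A)(\tilde y)=W(\hat b)$ is tail regular. *)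

(* Defs.v *)
From HB Require Import structures.
From mathcomp Require Import all_boot all_order all_algebra.
Set Implicit Arguments. Unset Strict Implicit. Unset Printing Implicit Defensive.
Import Order.TTheory GRing.Theory Num.Theory.
Local Open Scope ring_scope.

Notation ratf F := {fraction {poly F}}.
Notation "p %:F" := (@FracField.tofrac {poly _} p) (format "p %:F") : ring_scope.

(* (F(t), s) is a PiSigma-extension of the difference field (F, sF):
   s is an automorphism of F(t) (inverse given separately) extending sF,
   with s t = t + beta or s t = alpha * t (alpha, beta in F \ {0}),
   and with no new constants. *)
Definition PiSigma (F : fieldType) (sF : F -> F) (s : ratf F -> ratf F) : Prop :=
  [/\ (forall c : F, s (c%:P)%:F = (sF c)%:P%:F),
      (exists2 beta : F, beta != 0 & s ('X%:F) = 'X%:F + (beta%:P)%:F)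
      \/ (exists2 alpha : F, alpha != 0 & s ('X%:F) = (alpha%:P)%:F * 'X%:F)
    & (forall x : ratf F, s x = x -> exists c : F, x = (c%:P)%:F)].

Definition is_polyF (F : fieldType) (x : ratf F) : Prop :=
  exists p : {poly F}, x = p%:F.

(* Laurent Ore polynomials K[s, s^-1] over a difference field (K, s).   *)
(* An element  sum_{z in Z} a_z s^z  is represented canonically by the  *)
(* pair (neg, pos) of polynomials with                                  *)
(*   a_k = pos`_k  (k >= 0),   a_{-(k+1)} = neg`_k.                     *)
(* The Ore ring K[s] is the subset with neg = 0.                        *)

Definition lop (K : fieldType) := ({poly K} * {poly K})%type.

Section Ore.
Variable K : fieldType.
Variables (s si : K -> K). (* s an automorphism, si its inverse *)

Definition lcoef (a : lop K) (z : int) : K :=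
  match z with Posz k => a.2`_k | Negz k => a.1`_k end.

Definition siter (z : int) (x : K) : K :=
  match z with Posz k => iter k s x | Negz k => iter k.+1 si x end.

Definition lzero : lop K := (0, 0).
Definition lone : lop K := (0, 1).
Definition ladd (a b : lop K) : lop K := (a.1 + b.1, a.2 + b.2).
Definition lscale (c : K) (a : lop K) : lop K := (c *: a.1, c *: a.2).

(* coefficient of s^k in a*b = sum_i a_i s^i(b_{k-i}) *)
Definition lmulc (a b : lop K) (k : int) : K :=
  \sum_(i < size a.2) a.2`_i * siter (Posz i) (lcoef b (k - Posz i))
  + \sum_(i < size a.1) a.1`_i * siter (Negz i) (lcoef b (k - Negz i)).

Definition lmul (a b : lop K) : lop K :=
  (\poly_(k < size a.1 + size b.1) lmulc a b (Negz k),
   \poly_(k < size a.2 + size b.2) lmulc a b (Posz k)).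

Definition is_ore (a : lop K) : bool := a.1 == 0.

Definition lact (a : lop K) (x : K) : K :=
  \sum_(i < size a.2) a.2`_i * siter (Posz i) x
  + \sum_(i < size a.1) a.1`_i * siter (Negz i) x.

Definition ore_mx m n (A : 'M[lop K]_(m, n)) : Prop := forall i j, is_ore (A i j).

Definition lmulmx m n p (A : 'M[lop K]_(m, n)) (B : 'M[lop K]_(n, p))
  : 'M[lop K]_(m, p) :=
  \matrix_(i, j) \big[ladd/lzero]_(k < n) lmul (A i k) (B k j).

Definition lidmx n : 'M[lop K]_n :=
  \matrix_(i, j) if i == j then lone else lzero.

Definition lzeromx m n : 'M[lop K]_(m, n) := const_mx lzero.

Definition lscalemx m n (c : K) (A : 'M[lop K]_(m, n)) : 'M[lop K]_(m, n) :=
  \matrix_(i, j) lscale c (A i j).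

Definition lactmx m n (A : 'M[lop K]_(m, n)) (y : 'cV[K]_n) : 'cV[K]_m :=
  \col_i \sum_j lact (A i j) (y j 0).

Definition lunimod n (P P' : 'M[lop K]_n) : Prop :=
  lmulmx P P' = lidmx n /\ lmulmx P' P = lidmx n.

Definition ore_unimod n (P P' : 'M[lop K]_n) : Prop :=
  [/\ ore_mx P, ore_mx P' & lunimod P P'].

Definition rows_indep m n (A : 'M[lop K]_(m, n)) (S : {set 'I_m}) : Prop :=
  forall u : 'I_m -> lop K, (forall i, is_ore (u i)) ->
    (forall j, \big[ladd/lzero]_(i in S) lmul (u i) (A i j) = lzero) ->
    forall i, i \in S -> u i = lzero.

Definition ore_rank m n (A : 'M[lop K]_(m, n)) (r : nat) : Prop :=
  (exists2 S : {set 'I_m}, #|S| = r & rows_indep A S)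
  /\ (forall S : {set 'I_m}, rows_indep A S -> (#|S| <= r)%N).

Definition coefmx r (M : 'M[lop K]_r) (z : int) : 'M[K]_r :=
  \matrix_(i, j) lcoef (M i j) z.

Definition lorder r (M : 'M[lop K]_r) : nat :=
  (\max_(i < r) \max_(j < r) (size (M i j).2).-1)%N.

Definition head_regular r (M : 'M[lop K]_r) : bool :=
  \det (coefmx M (Posz (lorder M))) != 0.

Definition tail_regular r (M : 'M[lop K]_r) : bool :=
  \det (coefmx M 0) != 0.

(* regularity only depends on the operator matrix, not on the rhs *)
Definition fully_regular r (M : 'M[lop K]_r) : Prop :=
  head_regular M /\
  exists W W' : 'M[lop K]_r,
    [/\ lunimod W W', ore_mx (lmulmx W M) & tail_regular (lmulmx W M)].

End Ore.

Definition topv (K : Type) r m (h : (r <= m)%N) (v : 'cV[K]_m) : 'cV[K]_r :=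
  usubmx (castmx (esym (subnKC h), erefl 1%N) v).
Definition botv (K : Type) r m (h : (r <= m)%N) (v : 'cV[K]_m) : 'cV[K]_(m - r) :=
  dsubmx (castmx (esym (subnKC h), erefl 1%N) v).

(* Main.v *)
Require Import Defs.
From HB Require Import structures.
From mathcomp Require Import all_boot all_order all_algebra.
From mathcomp Require Import perm zify.
From Stdlib Require Import Classical_Prop.
Import Order.TTheory GRing.Theory Num.Theory.
Local Open Scope ring_scope.

Set Implicit Arguments. Unset Strict Implicit. Unset Printing Implicit Defensive.

(** The ring [K[sigma]] has left and right division by the order, so row and
    column operations bring [A] to the form [diag(d_1, ..., d_r, 0, ..., 0)] with
    all [d_i] nonzero.  As [P] may have entries in [K[sigma, sigma^-1]], the i-th
    row can in addition be multiplied by a power of [sigma]: this gives all the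
    [d_i] the same order, and then the leading coefficient matrix is diagonal and
    invertible.  Multiplying each row by a suitable negative power of [sigma]
    makes the constant coefficients nonzero, whence full regularity.  The number
    [r] is the row rank because homogeneous linear systems over [K[sigma]] with
    more unknowns than equations have nonzero solutions, on either side. *)

(** * Matrices over a ring with left and right Euclidean division *)

Section Equivalence.
Variable R : nzRingType.

Definition equivmx m n (A B : 'M[R]_(m, n)) : Prop :=
  exists (P P' : 'M[R]_m) (Q Q' : 'M[R]_n),
    [/\ P *m P' = 1%:M, P' *m P = 1%:M, Q *m Q' = 1%:M, Q' *m Q = 1%:M
      & B = P *m A *m Q].

Lemma equivmx_refl m n (A : 'M[R]_(m, n)) : equivmx A A.
Proof. by do 4!exists 1%:M; split; rewrite ?mulmx1 ?mul1mx. Qed.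

Lemma equivmx_trans m n (A B C : 'M[R]_(m, n)) :
  equivmx A B -> equivmx B C -> equivmx A C.
Proof.
move=> [P [P' [Q [Q' [h1 h2 h3 h4 ->]]]]] [T [T' [U [U' [k1 k2 k3 k4 ->]]]]].
exists (T *m P), (P' *m T'), (Q *m U), (U' *m Q'); split.
- by rewrite mulmxA -(mulmxA T) h1 mulmx1.
- by rewrite mulmxA -(mulmxA P') k2 mulmx1.
- by rewrite mulmxA -(mulmxA Q) k3 mulmx1.
- by rewrite mulmxA -(mulmxA U') h4 mulmx1.
- by rewrite !mulmxA.
Qed.

Lemma equivmx_mull m n (A : 'M[R]_(m, n)) (P P' : 'M[R]_m) :
  P *m P' = 1%:M -> P' *m P = 1%:M -> equivmx A (P *m A).
Proof. by move=> h h'; exists P, P', 1%:M, 1%:M; split; rewrite ?mulmx1. Qed.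

Lemma equivmx_mulr m n (A : 'M[R]_(m, n)) (Q Q' : 'M[R]_n) :
  Q *m Q' = 1%:M -> Q' *m Q = 1%:M -> equivmx A (A *m Q).
Proof. by move=> h h'; exists 1%:M, 1%:M, Q, Q'; split; rewrite ?mul1mx ?mulmx1. Qed.

Lemma equivmx_xrow m n (A : 'M[R]_(m, n)) i j : equivmx A (xrow i j A).
Proof.
by rewrite xrowE; apply: equivmx_mull (tperm_mx i j) _ _;
  rewrite -perm_mxM tperm2 perm_mx1.
Qed.

Lemma equivmx_xcol m n (A : 'M[R]_(m, n)) i j : equivmx A (xcol i j A).
Proof.
by rewrite xcolE; apply: equivmx_mulr (tperm_mx i j) _ _;
  rewrite -perm_mxM tperm2 perm_mx1.
Qed.

(** The row operation is left multiplication by a block unitriangular matrix, whose inverse is the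
    one for [- q]. As the ring need not be commutative, [q] stays on the left of [a] and [u]. *)
Lemma equivmx_row_transvection m n a (u : 'rV[R]_n) (v : 'cV[R]_m) B (q : 'cV[R]_m) :
  equivmx (block_mx a u v B : 'M_(1 + m, 1 + n))
          (block_mx a u (v - q *m a) (B - q *m u)).
Proof.
have E (x : 'cV[R]_m) : block_mx 1%:M 0 (- x) 1%:M *m block_mx 1%:M 0 x 1%:M
   = 1%:M :> 'M_(1 + m).
  by rewrite mulmx_block !mul1mx !mulmx1 !mulmx0 !mul0mx addNr !add0r !addr0
     -scalar_mx_block.
have -> : block_mx a u (v - q *m a) (B - q *m u) =
  block_mx 1%:M 0 (- q) 1%:M *m block_mx a u v B :> 'M_(1 + m, 1 + n).
  by rewrite mulmx_block !mul1mx !mul0mx !addr0 !mulNmx ![- _ + _]addrC.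
apply: (equivmx_mull _ (E q)).
by have := E (- q); rewrite opprK.
Qed.

Lemma equivmx_col_transvection m n a (u : 'rV[R]_n) (v : 'cV[R]_m) B (q : 'rV[R]_n) :
  equivmx (block_mx a u v B : 'M_(1 + m, 1 + n))
          (block_mx a (u - a *m q) v (B - v *m q)).
Proof.
have E (x : 'rV[R]_n) : block_mx 1%:M (- x) 0 1%:M *m block_mx 1%:M x 0 1%:M
   = 1%:M :> 'M_(1 + n).
  by rewrite mulmx_block !mul1mx !mulmx1 !mulmx0 !mul0mx subrr !add0r !addr0
     -scalar_mx_block.
have -> : block_mx a (u - a *m q) v (B - v *m q) =
  block_mx a u v B *m block_mx 1%:M (- q) 0 1%:M :> 'M_(1 + m, 1 + n).
  by rewrite mulmx_block !mulmx1 !mulmx0 !addr0 !mulmxN ![- _ + _]addrC.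
apply: (equivmx_mulr _ (E q)).
by have := E (- q); rewrite opprK.
Qed.

Lemma equivmx_block_diag m n (a : 'M[R]_1) (B C : 'M[R]_(m, n)) :
  equivmx B C ->
  equivmx (block_mx a 0 0 B : 'M_(1 + m, 1 + n)) (block_mx a 0 0 C).
Proof.
move=> [P [P' [Q [Q' [h1 h2 h3 h4 ->]]]]].
exists (block_mx 1%:M 0 0 P), (block_mx 1%:M 0 0 P'),
  (block_mx 1%:M 0 0 Q), (block_mx 1%:M 0 0 Q').
split; rewrite !mulmx_block ?(mulmx0, mul0mx, mul1mx, mulmx1, addr0, add0r,
  h1, h2, h3, h4) -?scalar_mx_block //.
Qed.

(** Indexing [d] by [nat] lets one sequence serve matrices of different sizes, and be shifted by one
    when a pivot is split off. *)
Definition diagmx_of m n (r : nat) (d : nat -> R) : 'M[R]_(m, n) :=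
  \matrix_(i, j) if (i == j :> nat) && (i < r)%N then d i else 0.

End Equivalence.

Section EuclideanMatrices.
Variables (R : nzRingType) (deg : R -> nat).
Hypothesis mulf_eq0 : forall a b : R, a * b = 0 -> a = 0 \/ b = 0.
Hypothesis ldiv : forall a b : R, b != 0 ->
  exists q, (deg (a - q * b)%R < deg b)%N.
Hypothesis rdiv : forall a b : R, b != 0 ->
  exists q, (deg (a - b * q)%R < deg b)%N.

(** Induction on the degree of a nonzero entry. This entry is moved to the corner; left division
    reduces the first column and right division the first row. A nonzero remainder has smaller
    degree and becomes the next pivot; if all remainders vanish, the corner has split off. *)
Lemma pivot_mx m n (A : 'M[R]_(1 + m, 1 + n)) :
  A != 0 -> exists (a : 'M[R]_1) (B : 'M[R]_(m, n)),
    a != 0 /\ equivmx A (block_mx a 0 0 B).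
Proof.
have nz p q (M : 'M[R]_(p, q)) : M != 0 -> exists i j, M i j != 0.
  case: (pickP (fun ij => M ij.1 ij.2 != 0)) => [[i j] Mij _|M0 /eqP[]].
    by exists i, j.
  by apply/matrixP=> i j; have /eqP := M0 (i, j); rewrite mxE.
move=> /nz[i0 [j0]]; have [k] := ubnP (deg (A i0 j0)).
elim: k A i0 j0 => // k IH A i0 j0; rewrite ltnS => degA Aij.
pose A1 : 'M_(1 + m, 1 + n) :=
  xrow (lshift m 0) i0 (xcol (lshift n 0) j0 A).
have eA1 : equivmx A A1.
  exact: equivmx_trans (equivmx_xcol _ _ _) (equivmx_xrow _ _ _).
have A100 : A1 (lshift m 0) (lshift n 0) = A i0 j0 by rewrite !mxE !tpermL.
have [a [u [v [B defA]]]] : exists a u v B,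
    A1 = block_mx a u v B :> 'M_(1 + m, 1 + n).
  by exists (ulsubmx A1), (ursubmx A1), (dlsubmx A1), (drsubmx A1); rewrite submxK.
have Ea : a 0 0 = A i0 j0.
  by rewrite -A100 defA block_mxEul.
have a00 : a 0 0 != 0 by rewrite Ea.
move: degA; rewrite -Ea => dega {Ea A100}.
rewrite {}defA in eA1 => {A1}.
(* The quotients for all entries of the column are chosen at once, so that a single transvection
   replaces the column by its remainders. *)
have [q qP] := fin_all_exists (fun i => ldiv (v i 0) a00).
have {}eA1 := equivmx_trans eA1 (equivmx_row_transvection a u v B (\col_i q i)).
set v' := v - _ in eA1; set B' := B - _ in eA1.
have v'E i : v' i 0 = v i 0 - q i * a 0 0 by rewrite !mxE big_ord1 mxE.
have [v'0|/nz[i [j v'i]]] := eqVneq v' 0; last first.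
  rewrite (ord1 j) in v'i.
  have [||a' [B2 [a'0 e]]] := IH (block_mx a u v' B') (rshift 1 i) (lshift n 0).
  - by rewrite block_mxEdl v'E; apply: leq_trans (qP i) dega.
  - by rewrite block_mxEdl.
  by exists a', B2; split=> //; apply: equivmx_trans eA1 e.
have [p pP] := fin_all_exists (fun j => rdiv (u 0 j) a00).
have {}eA1 := equivmx_trans eA1 (equivmx_col_transvection a u v' B' (\row_j p j)).
set u' := u - _ in eA1; set B2 := B' - _ in eA1.
have u'E j : u' 0 j = u 0 j - a 0 0 * p j by rewrite !mxE big_ord1 mxE.
have [u'0|/nz[j [i u'i]]] := eqVneq u' 0; last first.
  rewrite (ord1 j) in u'i.
  have [||a' [B3 [a'0 e]]] := IH (block_mx a u' v' B2) (lshift m 0) (rshift 1 i).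
  - by rewrite block_mxEur u'E; apply: leq_trans (pP i) dega.
  - by rewrite block_mxEur.
  by exists a', B3; split=> //; apply: equivmx_trans eA1 e.
exists a, B2; rewrite u'0 v'0 in eA1; split=> //.
by apply: contraNneq a00 => ->; rewrite mxE.
Qed.

Lemma diagonalize m n (A : 'M[R]_(m, n)) : exists (r : nat) (d : nat -> R),
  [/\ (r <= m)%N, (r <= n)%N, forall i, (i < r)%N -> d i != 0
    & equivmx A (diagmx_of m n r d)].
Proof.
elim: m n A => [|m IH] n A.
  exists 0, (fun=> 0); split=> //; rewrite [diagmx_of _ _ _ _]flatmx0 (flatmx0 A).
  exact: equivmx_refl.
case: n A => [|n] A.
  exists 0, (fun=> 0); split=> //; rewrite [diagmx_of _ _ _ _]thinmx0 (thinmx0 A).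
  exact: equivmx_refl.
have [->|A0] := eqVneq A 0.
  exists 0, (fun=> 0); split=> //.
  have -> : diagmx_of m.+1 n.+1 0 (fun=> 0) = 0 :> 'M[R]_(_, _).
    by apply/matrixP=> i j; rewrite !mxE ltn0 andbF.
  exact: equivmx_refl.
have [a [B [a0 eA]]] := @pivot_mx m n A A0.
have [r [d [rm rn d0 eB]]] := IH n B.
exists r.+1, (fun i => if i is i'.+1 then d i' else a 0 0); split=> //.
  case=> [_|i ri]; last exact: d0.
  apply: contraNneq a0 => a00; apply/eqP/matrixP=> i j.
  by rewrite !ord1 a00 mxE.
apply: equivmx_trans eA _.
suff -> : diagmx_of m.+1 n.+1 r.+1 (fun i => if i is i'.+1 then d i' else a 0 0)
  = block_mx a 0 0 (diagmx_of m n r d) :> 'M_(1 + m, 1 + n).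
  exact: equivmx_block_diag.
apply/matrixP=> i j; rewrite mxE.
case: (split_ordP i) => i' ->; case: (split_ordP j) => j' ->.
- by rewrite block_mxEul !ord1.
- by rewrite block_mxEur !ord1 mxE.
- by rewrite block_mxEdl !ord1 mxE.
- by rewrite block_mxEdr mxE /= !add1n eqSS ltnS.
Qed.

(** A diagonal form [P N Q] has at most [n] nonzero rows, so its row of index [n] is zero; the
    corresponding row of [P] is nonzero and annihilates [N]. *)
Lemma left_kernel_nonzero m n (N : 'M[R]_(m, n)) :
  (n < m)%N -> exists2 u : 'rV[R]_m, u != 0 & u *m N = 0.
Proof.
move=> nm; have [r [d [_ rn _]]] := diagonalize N.
move=> [P [P' [Q [Q' [h1 h2 h3 h4 E]]]]].
pose e : 'rV[R]_m := delta_mx 0 (Ordinal nm).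
exists (e *m P).
  apply/eqP=> eP0; have /matrixP/(_ 0 (Ordinal nm)) : e = 0.
    by rewrite -[e]mulmx1 -h1 mulmxA eP0 mul0mx.
  by rewrite !mxE !eqxx => /eqP; rewrite oner_eq0.
have -> : e *m P *m N = e *m (P *m N *m Q) *m Q'.
  by rewrite !mulmxA -(mulmxA _ Q) h3 mulmx1.
rewrite -E; suff -> : e *m diagmx_of m n r d = 0 by rewrite mul0mx.
apply/matrixP=> i j; rewrite -rowE !mxE /=.
by rewrite ltnNge rn andbF.
Qed.

(** Here the column of index [m] of the diagonal form is zero, and the corresponding column of [Q]
    lies in the kernel. *)
Lemma right_kernel_nonzero m n (N : 'M[R]_(m, n)) :
  (m < n)%N -> exists2 v : 'cV[R]_n, v != 0 & N *m v = 0.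
Proof.
move=> nm; have [r [d [rm _ _]]] := diagonalize N.
move=> [P [P' [Q [Q' [h1 h2 h3 h4 E]]]]].
pose e : 'cV[R]_n := delta_mx (Ordinal nm) 0.
exists (Q *m e).
  apply/eqP=> eP0; have /matrixP/(_ (Ordinal nm) 0) : e = 0.
    by rewrite -[e]mul1mx -h4 -mulmxA eP0 mulmx0.
  by rewrite !mxE !eqxx => /eqP; rewrite oner_eq0.
have -> : N *m (Q *m e) = P' *m ((P *m N *m Q) *m e).
  by rewrite !mulmxA h2 mul1mx.
rewrite -E; suff -> : diagmx_of m n r d *m e = 0 by rewrite mulmx0.
apply/matrixP=> i j; rewrite -colE !mxE /=.
by case: eqP => //= ->; rewrite ltnNge rm.
Qed.

(** * Row rank read off from a diagonal form *)

Definition left_indep m n (A : 'M[R]_(m, n)) (S : {set 'I_m}) : Prop :=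
  forall u : 'I_m -> R, (forall j, \sum_(i in S) u i * A i j = 0) ->
  forall i, i \in S -> u i = 0.

Section Rank.
Variables (m n r : nat) (A : 'M[R]_(m, n)) (d : nat -> R).
Hypotheses (rm : (r <= m)%N) (rn : (r <= n)%N).
Hypothesis d_neq0 : forall i, (i < r)%N -> d i != 0.
Hypothesis A_diag : equivmx A (diagmx_of m n r d).

(** Writing [A = P' (D Q')] with [D] diagonal, only the first [r] rows of [D Q'] can be nonzero.
    More than [r] rows of [A] are thus left combinations of [r] rows, and a left kernel vector of
    the coefficients is a relation between them. *)
Lemma left_indep_card (S : {set 'I_m}) : left_indep A S -> (#|S| <= r)%N.
Proof.
move=> indS; rewrite leqNgt; apply/negP => rS.
have [P [P' [Q [Q' [h1 h2 h3 h4 E]]]]] := A_diag.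
have [u u0 uN] := left_kernel_nonzero
  (\matrix_(k < #|S|, j < r) P' (enum_val k) (widen_ord rm j)) rS.
(* This carries [u] from positions in the enumeration of [S] to row indices: on [S] the sum has
   exactly one term. *)
pose w i := \sum_(k < #|S| | enum_val k == i) u 0 k.
have wE k : w (enum_val k) = u 0 k.
  by rewrite /w (big_pred1 k) // => l; rewrite (inj_eq enum_val_inj).
case/eqP: u0; apply/matrixP=> i0 k; rewrite ord1 mxE -wE.
apply: indS (enum_valP k) => j {k i0}; rewrite big_enum_val /=.
have -> : A = P' *m (diagmx_of m n r d *m Q').
  by rewrite E -!mulmxA h3 mulmx1 mulmxA h2 mul1mx.
set M := _ *m Q'.
have M0 (l : 'I_m) : (r <= l)%N -> M l j = 0.
  move=> rl; rewrite mxE big1 // => l' _.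
  by rewrite mxE [(l < r)%N]ltnNge rl andbF mul0r.
under eq_bigr do rewrite wE mxE big_distrr /=.
rewrite exchange_big /= big1 // => l _.
under eq_bigr do rewrite mulrA.
rewrite -big_distrl /=.
have [lr|rl] := ltnP l r; last by rewrite M0 ?mulr0.
move/matrixP/(_ 0 (Ordinal lr)): uN; rewrite !mxE => uN.
rewrite [X in X * _](_ : _ = 0) ?mul0r // -[RHS]uN.
apply: eq_bigr => k _; rewrite mxE; congr (_ * P' _ _); exact: val_inj.
Qed.

(** Otherwise every row of [A] has a nonzero left multiple in the left span of the rows in [S]. With
    fewer than [r] such rows, some nonzero [v] of length [r], padded with zeros, is killed by the
    rows in [S] of [A Q]. In the absence of zero divisors all rows of [A Q] kill it, hence so does
    the diagonal form, which forces [v = 0]. *)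
Lemma left_indep_extend (S : {set 'I_m}) : left_indep A S -> (#|S| < r)%N ->
  exists2 i, i \notin S & left_indep A (i |: S).
Proof.
move=> indS Sr; apply: NNPP => nex.
(* For [i] outside [S], adjoining [i] yields a dependent set; as [S] is independent, the relation
   has a nonzero coefficient at [i]. *)
have dep (i : 'I_m) : exists cg : R * ('I_m -> R),
    cg.1 != 0 /\ forall j, cg.1 * A i j = \sum_(l in S) cg.2 l * A l j.
  have [iS|iS] := boolP (i \in S).
    exists (1, fun l => (l == i)%:R); split=> [|j] /=; first exact: oner_neq0.
    rewrite (bigD1 i) //= eqxx big1 ?addr0 // => l /andP[_ /negPf->].
    by rewrite mul0r.
  apply: NNPP => noc; apply: nex; exists i => // u uA.
  have ui0 : u i = 0.
    apply: NNPP => /eqP ui; apply: noc; exists (u i, fun l => - u l); split=> // j.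
    have := uA j; rewrite big_setU1 //= => /eqP; rewrite addr_eq0 => /eqP ->.
    by rewrite -sumrN; apply: eq_bigr => l _; rewrite mulNr.
  move=> l; rewrite !inE => /orP[/eqP->//|]; apply: indS => j.
  by have := uA j; rewrite big_setU1 //= ui0 mul0r add0r.
have [P [P' [Q [Q' [h1 h2 h3 h4 E]]]]] := A_diag.
have {dep}[cg cgP] := fin_all_exists dep.
(* [J] embeds vectors of length [r] as the first [r] coordinates, where the diagonal form has its
   nonzero entries. *)
pose J : 'M[R]_(n, r) := \matrix_(i, j) (i == j :> nat)%:R.
have [v v0 Nv] := right_kernel_nonzero
  (\matrix_(k < #|S|, j < r) (A *m Q *m J) (enum_val k) j) Sr.
pose x := A *m Q *m J *m v.
have xS l : l \in S -> x l 0 = 0.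
  move=> lS; rewrite -(enum_rankK_in lS lS).
  move/matrixP/(_ (enum_rank_in lS l) 0): Nv; rewrite !mxE => Nv.
  by rewrite -[RHS]Nv; apply: eq_bigr => k _; rewrite [in RHS]mxE.
have x0 : x = 0.
  apply/matrixP=> i k; rewrite ord1 [RHS]mxE.
  have [ci cE] := cgP i.
  (* The relation for row [i], multiplied on the right by [Q J v], expresses a nonzero multiple of
     [x i 0] through the entries [x l 0] with [l] in [S], which vanish. *)
  suff /mulf_eq0[/eqP|//] : (cg i).1 * x i 0 = 0 by rewrite (negPf ci).
  rewrite /x -!mulmxA mxE; set y := _ *m _; rewrite big_distrr /=.
  under eq_bigr do rewrite mulrA cE big_distrl /=.
  rewrite exchange_big big1 //= => l lS.
  under eq_bigr do rewrite -mulrA.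
  rewrite -big_distrr /=; have := xS l lS.
  by rewrite /x -!mulmxA mxE => ->; rewrite mulr0.
case/eqP: v0; apply/matrixP=> k i0; rewrite ord1 [RHS]mxE.
have : (diagmx_of m n r d *m (J *m v)) (widen_ord rm k) 0 = 0.
  have -> : diagmx_of m n r d *m (J *m v) = P *m x by rewrite E /x !mulmxA.
  by rewrite x0 mulmx0 mxE.
rewrite mxE (bigD1 (widen_ord rn k)) //= big1; last first.
  move=> j jk; rewrite !mxE /=; case: eqP => [kj|_]; last by rewrite mul0r.
  by case/eqP: jk; apply: val_inj.
rewrite addr0 !mxE /= eqxx ltn_ord /= (bigD1 k) //= big1; last first.
  move=> j jk; rewrite mxE /= eq_sym; case: eqP => [kj|_]; last by rewrite mul0r.
  by case/eqP: jk; apply: val_inj.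
rewrite mxE eqxx mul1r addr0 => /mulf_eq0[/eqP|//].
by rewrite (negPf (d_neq0 (ltn_ord k))).
Qed.

Lemma left_indep_exists : exists2 S : {set 'I_m}, #|S| = r & left_indep A S.
Proof.
suff H k : (k <= r)%N -> exists2 S : {set 'I_m}, #|S| = k & left_indep A S by exact: H.
elim: k => [_|k IH kr].
  by exists set0; rewrite ?cards0 // => u _ i; rewrite inE.
have [S Sk indS] := IH (ltnW kr).
have [|i iS indiS] := left_indep_extend indS; first by rewrite Sk.
by exists (i |: S); rewrite // cardsU1 iS Sk.
Qed.

End Rank.
End EuclideanMatrices.

(** * Laurent Ore operators *)

Section Laurent.
Variables (K : fieldType) (s : {rmorphism K -> K}) (si : K -> K).
Hypotheses (sK : cancel s si) (siK : cancel si s).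

Local Notation sz := (siter s si).
Local Notation "a ** b" := (lmul s si a b) (at level 40).

Lemma si_zmod_morphism : zmod_morphism si.
Proof. exact: can2_zmod_morphism sK siK. Qed.
Lemma si_monoid_morphism : monoid_morphism si.
Proof. exact: can2_monoid_morphism sK siK. Qed.

Lemma siter_zmod_morphism z : zmod_morphism (sz z).
Proof.
move=> x y; case: z => k /=; first by elim: k => //= k ->; rewrite rmorphB.
rewrite -[RHS]si_zmod_morphism; congr (si _).
by elim: k => //= k ->; rewrite si_zmod_morphism.
Qed.
Lemma siter_monoid_morphism z : monoid_morphism (sz z).
Proof.
have [s1 sM] := si_monoid_morphism.
split=> [|x y]; case: z => k /=.
- by elim: k => //= k ->; rewrite rmorph1.
- by rewrite -[RHS]s1; congr (si _); elim: k => //= k ->.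
- by elim: k => //= k ->; rewrite rmorphM.
- by rewrite -sM; congr (si _); elim: k => //= k ->.
Qed.

HB.instance Definition _ z :=
  GRing.isZmodMorphism.Build K K (sz z) (siter_zmod_morphism z).
HB.instance Definition _ z :=
  GRing.isMonoidMorphism.Build K K (sz z) (siter_monoid_morphism z).

Lemma siter1 z x : sz (z + 1) x = s (sz z x).
Proof.
case: z => [k|[|k]].
- by rewrite (_ : Posz k + 1 = k.+1) //; lia.
- by rewrite NegzE addNr /= siK.
- by rewrite (_ : Negz k.+1 + 1 = Negz k) /= ?siK; last by lia.
Qed.

Lemma siterB1 z x : sz (z - 1) x = si (sz z x).
Proof. by rewrite -[in RHS](subrK 1 z) siter1 sK. Qed.

Lemma siterD z w x : sz (z + w) x = sz z (sz w x).
Proof.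
elim: z => [|k IH|k IH]; first by rewrite add0r.
- by rewrite -addn1 PoszD addrAC !siter1 IH.
- by rewrite -addn1 PoszD opprD addrAC !siterB1 IH.
Qed.

Lemma siter_eq0 z x : (sz z x == 0) = (x == 0).
Proof. exact: fmorph_eq0. Qed.

Lemma siter_1 z : sz z 1 = 1.
Proof. exact: rmorph1. Qed.
Lemma siter_0 z : sz z 0 = 0.
Proof. exact: raddf0. Qed.

Lemma siterNK z : cancel (sz (- z)) (sz z).
Proof. by move=> x; rewrite -siterD subrr. Qed.

Lemma lcoefP (a b : lop K) : lcoef a =1 lcoef b -> a = b.
Proof.
case: a b => [a1 a2] [b1 b2] ab; congr pair; apply/polyP=> k.
- exact: (ab (Negz k)).
- exact: (ab (Posz k)).
Qed.

(** The index comes first so that the partial application is a map that can be declared additive and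
    commutes with finite sums. *)
Definition lcoef_at z (a : lop K) : K := lcoef a z.
Lemma lcoef_at_zmod_morphism z : zmod_morphism (lcoef_at z).
Proof. by move=> a b; case: z => k /=; rewrite /lcoef_at /= coefB. Qed.
HB.instance Definition _ z :=
  GRing.isZmodMorphism.Build (lop K) K (lcoef_at z) (lcoef_at_zmod_morphism z).

Lemma lcoef0 z : lcoef (0 : lop K) z = 0.
Proof. by case: z => k /=; rewrite coef0. Qed.
Lemma lcoefD (a b : lop K) z : lcoef (a + b) z = lcoef a z + lcoef b z.
Proof. exact: (raddfD (lcoef_at z)). Qed.
Lemma lcoefB (a b : lop K) z : lcoef (a - b) z = lcoef a z - lcoef b z.
Proof. exact: (raddfB (lcoef_at z)). Qed.

Lemma lcoef_pos_ge (a : lop K) (k : nat) : (size a.2 <= k)%N -> lcoef a k = 0.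
Proof. exact: nth_default. Qed.
Lemma lcoef_neg_ge (a : lop K) (k : nat) : (size a.1 <= k)%N -> lcoef a (Negz k) = 0.
Proof. exact: nth_default. Qed.

(** The truncation in [lmul] loses nothing: beyond the sum of the sizes, every summand of the
    convolution refers to a coefficient of [b] outside its support. *)
Lemma lcoef_lmul a b z : lcoef (a ** b) z = lmulc s si a b z.
Proof.
have le1 p q k i : (p + q <= k -> q <= k + i)%N by lia.
have le2 p q k i : (p + q <= k -> i < p -> i < k /\ q <= (k - i).-1)%N by lia.
case: z => k; rewrite /= coef_poly; case: ltnP => // kab; rewrite /lmulc.
- rewrite big1 ?big1 ?addr0 // => i _;
    move: (ltn_ord i); move: (nat_of_ord i) => {}i ia.
  + rewrite (_ : Posz k - Negz i = (k + i.+1)%N); last by lia.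
    by rewrite lcoef_pos_ge ?raddf0 ?mulr0 //; apply: le1 kab.
  + have [ik bk] := le2 _ _ _ _ kab ia.
    rewrite (_ : Posz k - Posz i = (k - i)%N); last by lia.
    by rewrite lcoef_pos_ge ?raddf0 ?mulr0 //; apply: leq_trans bk (leq_pred _).
- rewrite big1 ?big1 ?addr0 // => i _;
    move: (ltn_ord i); move: (nat_of_ord i) => {}i ia.
  + have [ik bk] := le2 _ _ _ _ kab ia.
    rewrite (_ : Negz k - Negz i = Negz (k - i).-1); last by lia.
    by rewrite lcoef_neg_ge ?raddf0 ?mulr0.
  + rewrite (_ : Negz k - Posz i = Negz (k + i)); last by lia.
    by rewrite lcoef_neg_ge ?raddf0 ?mulr0 //; apply: le1 kab.
Qed.

(** * Monomials, and the ring laws reduced to them *)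

Definition lmonom (c : K) (z : int) : lop K :=
  match z with Posz k => (0, c *: 'X^k) | Negz k => (c *: 'X^k, 0) end.

Lemma lcoef_lmonom c z w : lcoef (lmonom c z) w = if w == z then c else 0.
Proof.
have if_nat (b : bool) : c * b%:R = if b then c else 0.
  by case: b; rewrite ?mulr1 ?mulr0.
by case: z => k; case: w => l; rewrite /= ?coef0 // coefZ coefXn if_nat.
Qed.

Arguments lmonom : simpl never.

(** Every operator is a finite sum of monomials, so identities that are additive in an operator need
    checking only on monomials. *)
Lemma lop_ind (P : lop K -> Prop) :
  (forall a b, P a -> P b -> P (a + b)) -> (forall c z, P (lmonom c z)) ->
  forall a, P a.
Proof.
move=> PD PM; have P0 : P 0.
  suff -> : 0 = lmonom 0 0 by [].
  by apply: lcoefP => z; rewrite lcoef_lmonom lcoef0; case: ifP.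
case=> a1 a2; rewrite (_ : (a1, a2) =
  \sum_(i < size a1) lmonom a1`_i (Negz i) + \sum_(i < size a2) lmonom a2`_i (Posz i)).
  by apply: (PD); apply: (big_ind P P0 PD) => i _; apply: PM.
apply: lcoefP => z.
rewrite lcoefD -!/(lcoef_at z _) !raddf_sum /=.
under eq_bigr do rewrite [lcoef_at _ _]lcoef_lmonom.
under [X in _ + X]eq_bigr do rewrite [lcoef_at _ _]lcoef_lmonom.
case: z => k /=.
- rewrite big1 // add0r; have [ka|ka] := leqP (size a2) k.
    rewrite nth_default // big1 // => i _; case: eqP => // -[] ki.
    by move: ka; rewrite ki leqNgt ltn_ord.
  rewrite (bigD1 (Ordinal ka)) //= eqxx big1 ?addr0 // => i ik.
  by case: eqP => // -[] ki; case/eqP: ik; apply: val_inj.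
- rewrite addrC big1 // add0r; have [ka|ka] := leqP (size a1) k.
    rewrite nth_default // big1 // => i _; case: eqP => // -[] ki.
    by move: ka; rewrite ki leqNgt ltn_ord.
  rewrite (bigD1 (Ordinal ka)) //= eqxx big1 ?addr0 // => i ik.
  by case: eqP => // -[] ki; case/eqP: ik; apply: val_inj.
Qed.

(* Common shape of [lmulc] and [lact]: additivity in the operator is proved once. *)
Definition lsum (a : lop K) (f : int -> K) : K :=
  \sum_(i < size a.2) a.2`_i * f (Posz i) + \sum_(i < size a.1) a.1`_i * f (Negz i).

(** A common bound [N] for both halves replaces the ranges that depend on [a], so that the sums for
    several operators can be added termwise. *)
Lemma lsumE N (a : lop K) f : (size a.1 <= N)%N -> (size a.2 <= N)%N ->
  lsum a f = \sum_(i < N) (lcoef a (Posz i) * f (Posz i) + lcoef a (Negz i) * f (Negz i)).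
Proof.
move=> a1N a2N; rewrite big_split /=.
have widen (p : {poly K}) g : (size p <= N)%N ->
    \sum_(i < size p) p`_i * g (i : nat) = \sum_(i < N) p`_i * g i.
  move=> pN; rewrite -!(big_mkord xpredT (fun i => p`_i * g i)).
  rewrite [RHS](big_cat_nat (leq0n _) pN) /= [X in _ + X]big_nat_cond.
  rewrite [X in _ + X]big1 ?addr0 //.
  by move=> i /andP[/andP[pi _] _]; rewrite nth_default // mul0r.
by rewrite /lsum (widen _ (fun i => f (Posz i))) ?(widen _ (fun i => f (Negz i))).
Qed.

Lemma lsumD a b f : lsum (a + b) f = lsum a f + lsum b f.
Proof.
pose N := maxn (maxn (size a.1) (size a.2)) (maxn (size b.1) (size b.2)).
have [a1N a2N] : (size a.1 <= N)%N /\ (size a.2 <= N)%N.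
  by rewrite !leq_max !leqnn ?orbT.
have [b1N b2N] : (size b.1 <= N)%N /\ (size b.2 <= N)%N.
  by rewrite !leq_max !leqnn ?orbT.
have DN (p q : {poly K}) : (size p <= N -> size q <= N -> size (p + q)%R <= N)%N.
  by move=> pN qN; apply: leq_trans (size_polyD _ _) _; rewrite geq_max pN.
rewrite !(@lsumE N) ?DN // -big_split /=.
by apply: eq_bigr => i _; rewrite !coefD !mulrDl addrACA.
Qed.

Lemma lsum_lmonom c z f : lsum (lmonom c z) f = c * f z.
Proof.
(* This exceeds the position of the only possible nonzero coefficient, whichever the sign of [z]. *)
pose N := `|z|.+1.
have szX k : (size (c *: 'X^k)%R <= k.+1)%N.
  by apply: leq_trans (size_scale_leq _ _) _; rewrite size_polyXn.
have ltzN k : z = Posz k -> (k < N)%N by rewrite /N => ->; lia.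
have ltnN k : z = Negz k -> (k < N)%N by rewrite /N => ->; lia.
rewrite (@lsumE N); last 2 first.
- case: z @N ltzN ltnN => k N _ kN /=; first by rewrite size_poly0.
  exact: leq_trans (szX k) (kN _ _).
- case: z @N ltzN ltnN => k N kN _ /=; last by rewrite size_poly0.
  exact: leq_trans (szX k) (kN _ _).
rewrite (eq_bigr (fun i : 'I_N => (if z == Posz i then c * f z else 0)
  + (if z == Negz i then c * f z else 0))); last first.
  move=> i _; rewrite !lcoef_lmonom ![_ == z]eq_sym.
  by congr (_ + _); case: eqP => [<-|]; rewrite ?mul0r.
rewrite big_split /=; move: ltzN ltnN; move: N => N.
case: z => k ltz ltn /=.
- rewrite [X in _ + X]big1 // addr0 (bigD1 (Ordinal (ltz k erefl))) //= eqxx.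
  rewrite big1 ?addr0 // => i ik.
  by case: eqP => // -[] ki; case/eqP: ik; apply: val_inj.
- rewrite [X in X + _]big1 // add0r (bigD1 (Ordinal (ltn k erefl))) //= eqxx.
  rewrite big1 ?addr0 // => i ik.
  by case: eqP => // -[] ki; case/eqP: ik; apply: val_inj.
Qed.

Lemma lcoef_lmulE a b z : lcoef (a ** b) z = lsum a (fun w => sz w (lcoef b (z - w))).
Proof. exact: lcoef_lmul. Qed.

Lemma lactE a x : lact s si a x = lsum a (fun w => sz w x).
Proof. by []. Qed.

Lemma lmulDl : left_distributive (lmul s si) +%R.
Proof. by move=> a b c; apply: lcoefP => z; rewrite lcoefD !lcoef_lmulE lsumD. Qed.

Lemma lsumDr a f g : lsum a (fun z => f z + g z) = lsum a f + lsum a g.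
Proof.
rewrite /lsum addrACA -!big_split /=.
by congr (_ + _); apply: eq_bigr => i _; rewrite mulrDr.
Qed.

Lemma eq_lsum a f g : f =1 g -> lsum a f = lsum a g.
Proof. by move=> fg; congr (_ + _); apply: eq_bigr => i _; rewrite fg. Qed.

Lemma lmulDr : right_distributive (lmul s si) +%R.
Proof.
move=> a b c; apply: lcoefP => z; rewrite lcoefD !lcoef_lmulE -lsumDr.
by apply: eq_lsum => w; rewrite lcoefD raddfD.
Qed.

Lemma lcoef_lmonomM c z b w : lcoef (lmonom c z ** b) w = c * sz z (lcoef b (w - z)).
Proof. by rewrite lcoef_lmulE lsum_lmonom. Qed.

Lemma lmonomM c z d w : lmonom c z ** lmonom d w = lmonom (c * sz z d) (z + w).
Proof.
apply: lcoefP => y; rewrite lcoef_lmonomM !lcoef_lmonom subr_eq [w + z]addrC.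
by case: eqP; rewrite ?raddf0 ?mulr0.
Qed.

(** Both sides are additive in each argument. On monomials the claim amounts to [sz z] being
    multiplicative and [sz (z + w)] being the composite of [sz z] and [sz w]. *)
Lemma lmulA : associative (lmul s si).
Proof.
move=> a b c; elim/lop_ind: a => [a a' IH IH'|x z]; first by rewrite !lmulDl IH IH'.
elim/lop_ind: b => [b b' IH IH'|y w]; first by rewrite !(lmulDl, lmulDr) IH IH'.
elim/lop_ind: c => [c c' IH IH'|t v]; first by rewrite !lmulDr IH IH'.
by rewrite !lmonomM rmorphM siterD mulrA addrA.
Qed.

Lemma lone_lmonom : lone K = lmonom 1 0.
Proof. apply: lcoefP => -[k|k]; rewrite lcoef_lmonom /= ?coef0 //.
by rewrite coef1; case: k. Qed.

Lemma lmul1 : left_id (lone K) (lmul s si).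
Proof.
by move=> a; apply: lcoefP => z; rewrite lone_lmonom lcoef_lmonomM mul1r subr0.
Qed.

Lemma lmulr1 : right_id (lone K) (lmul s si).
Proof.
rewrite lone_lmonom => a; elim/lop_ind: a => [a a' IH IH'|x z].
  by rewrite lmulDl IH IH'.
by rewrite lmonomM rmorph1 mulr1 addr0.
Qed.

Lemma lone_neq0 : lone K != 0.
Proof. by apply/eqP=> -[] /eqP; rewrite oner_eq0. Qed.

Lemma lact_is_zmod_morphism a : zmod_morphism (lact s si a).
Proof.
move=> x y; elim/lop_ind: a => [a a' IH IH'|c z].
  by rewrite !lactE !lsumD -!lactE IH IH' [in RHS]opprD addrACA.
by rewrite !lactE !lsum_lmonom rmorphB mulrBr.
Qed.
HB.instance Definition _ a :=
  GRing.isZmodMorphism.Build K K (lact s si a) (lact_is_zmod_morphism a).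

Lemma lactD a b x : lact s si (a + b) x = lact s si a x + lact s si b x.
Proof. by rewrite !lactE lsumD. Qed.

Lemma lactM a b x : lact s si (a ** b) x = lact s si a (lact s si b x).
Proof.
elim/lop_ind: a => [a a' IH IH'|c z]; first by rewrite lmulDl !lactD IH IH'.
elim/lop_ind: b => [b b' IH IH'|d w]; first by rewrite lmulDr !lactD IH IH' [in RHS]raddfD.
by rewrite lmonomM !lactE !lsum_lmonom rmorphM siterD mulrA.
Qed.

Lemma lact1 x : lact s si (lone K) x = x.
Proof. by rewrite lone_lmonom lactE lsum_lmonom mul1r. Qed.

End Laurent.

Section LaurentRing.
Variables (K : fieldType) (s : {rmorphism K -> K}) (si : K -> K).
Hypotheses (sK : cancel s si) (siK : cancel si s).

(* The inverse laws are parameters of the type so that its ring instance is inferable. *)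
Definition lring : Type := let _ := (sK, siK) in lop K.

HB.instance Definition _ := GRing.Zmodule.copy lring (lop K).
HB.instance Definition _ := GRing.Zmodule_isNzRing.Build lring
  (lmulA sK siK) (lmul1 sK siK) (lmulr1 sK siK) (lmulDl sK siK) (lmulDr sK siK)
  (lone_neq0 K).

End LaurentRing.

(** * Ore operators *)

Local Arguments siter : simpl never.

Section Ore.
Variables (K : fieldType) (s : {rmorphism K -> K}) (si : K -> K).
Hypotheses (sK : cancel s si) (siK : cancel si s).

Local Notation sz := (siter s si).
Local Notation L := (lring sK siK).

Lemma is_oreP (a : lop K) : reflect (forall k, lcoef a (Negz k) = 0) (is_ore a).
Proof.
apply: (iffP eqP) => [a0 k|a0]; first by rewrite /= a0 coef0.
by apply/polyP=> k; rewrite coef0; apply: (a0 k).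
Qed.

Lemma lsum_ore (a : lop K) f : is_ore a ->
  lsum a f = \sum_(i < size a.2) a.2`_i * f (Posz i).
Proof. by move=> /eqP a0; rewrite /lsum a0 size_poly0 big_ord0 addr0. Qed.

Lemma lcoefM_ore (a b : L) z : is_ore a ->
  lcoef (a * b) z = \sum_(i < size a.2) a.2`_i * sz (Posz i) (lcoef b (z - Posz i)).
Proof. by move=> ore_a; apply: etrans (lcoef_lmulE sK siK a b z) (lsum_ore _ ore_a). Qed.

Definition ore_pred : {pred L} := fun a => is_ore a.

Lemma ore_subring_closed : subring_closed ore_pred.
Proof.
split=> [|a b|a b]; rewrite ?unfold_in /ore_pred.
- exact: eqxx.
- move=> /is_oreP a0 /is_oreP b0; apply/is_oreP => k.
  by rewrite [LHS]lcoefB a0 b0 subr0.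
- move=> ore_a /is_oreP b0; apply/is_oreP => k; rewrite lcoefM_ore //.
  rewrite big1 // => i _.
  by rewrite (_ : Negz k - Posz i = Negz (k + i)) ?b0 ?raddf0 ?mulr0 //; lia.
Qed.
HB.instance Definition _ := GRing.isSubringClosed.Build L ore_pred ore_subring_closed.

Definition ore := {a : L | a \in ore_pred}.
HB.instance Definition _ := [isSub of ore for sval].
HB.instance Definition _ := [Choice of ore by <:].
HB.instance Definition _ := [SubChoice_isSubNzRing of ore by <:].

Lemma val_oreB (a b : ore) : val (a - b) = val a - val b :> L.
Proof. exact: raddfB. Qed.
Lemma val_oreM (a b : ore) : val (a * b) = val a * val b :> L.
Proof. exact: (rmorphM (val : ore -> L)). Qed.

Lemma lmonom_ore c (k : nat) : (lmonom c k : L) \in ore_pred.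
Proof. exact: eqxx. Qed.

Definition mk_ore (a : lop K) (ore_a : is_ore a) : ore :=
  exist (fun a : L => a \in ore_pred) a ore_a.

Definition omonom c k : ore := mk_ore (lmonom_ore c k).

(** * Degree, absence of zero divisors and division on both sides *)

Lemma lcoefM_lmonom (b : L) c z w :
  lcoef (b * (lmonom c z : L)) w = lcoef b (w - z) * sz (w - z) c.
Proof.
elim/lop_ind: b => [b b' IH IH'|d v].
  pose x : L := lmonom c z.
  transitivity (lcoef ((b : L) * x) w + lcoef ((b' : L) * x) w).
    by rewrite -lcoefD; congr lcoef; apply: (mulrDl (b : L) b' x).
  by rewrite IH IH' -mulrDl -lcoefD.
rewrite (_ : (lmonom d v : L) * _ = lmonom (d * sz v c) (v + z)); last exact: lmonomM.
by rewrite !lcoef_lmonom subr_eq; case: eqP => [->|]; rewrite ?addrK ?mul0r.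
Qed.

(** This is the order plus one, so that the zero operator has degree [0], below every nonzero
    operator. *)
Definition odeg (a : ore) : nat := size (val a : lop K).2.

Lemma odeg_gt0 (a : ore) : a != 0 -> (0 < odeg a)%N.
Proof.
rewrite lt0n; apply: contra => a0; apply/eqP/val_inj/lcoefP => -[k|k].
  by rewrite lcoef0 /=; move: a0; rewrite size_poly_eq0 => /eqP ->; rewrite coef0.
by rewrite lcoef0 (is_oreP _ (valP a)).
Qed.

Lemma odeg_ltP (a : ore) n :
  reflect (forall j, (n <= j)%N -> lcoef (val a) (Posz j) = 0) (odeg a <= n)%N.
Proof. exact: leq_sizeP. Qed.

Definition olead (a : ore) : K := lcoef (val a) (odeg a).-1.

Lemma olead_neq0 (a : ore) : a != 0 -> olead a != 0.
Proof.
move=> /odeg_gt0 a0; rewrite /olead /= -/(lead_coef _) lead_coef_eq0.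
by rewrite -size_poly_eq0 -lt0n.
Qed.

(** The coefficient of the product at the sum of the orders is the leading coefficient of [a] times
    the image of that of [b] under a power of the automorphism, hence nonzero. *)
Lemma ore_mulf_eq0 (a b : ore) : a * b = 0 -> a = 0 \/ b = 0.
Proof.
have [->|a0] := eqVneq a 0; first by left.
have [->|b0] := eqVneq b 0; first by right.
move=> /(congr1 val)/(congr1 (fun x : L => lcoef x ((odeg a).-1 + (odeg b).-1)%N)).
rewrite [RHS]lcoef0 val_oreM lcoefM_ore; last exact: (valP a).
have alt : ((odeg a).-1 < odeg a)%N by rewrite prednK ?odeg_gt0.
rewrite (bigD1 (Ordinal alt)) //= big1.
  rewrite addr0 (_ : Posz _ - _ = (odeg b).-1); last by lia.
  move=> /eqP; rewrite mulf_eq0 siter_eq0 //.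
  by rewrite (negPf (olead_neq0 a0)) (negPf (olead_neq0 b0)).
move=> i ia; have {ia} : (i != (odeg a).-1 :> nat) by [].
have := ltn_ord i; rewrite -/(odeg a); move: (nat_of_ord i) => {}i ia ian.
have := odeg_gt0 b0; move: (odeg_gt0 a0) => ha hb.
rewrite (_ : Posz _ - _ = ((odeg a).-1 + (odeg b).-1 - i)%N); last by lia.
by rewrite (odeg_ltP _ _ (leqnn _)) ?raddf0 ?mulr0 //; lia.
Qed.

(* [f b q] stands for [q * b] (left division) or [b * q] (right division). *)
Lemma ore_division (f : ore -> ore -> ore) :
  (forall b q q', f b (q + q') = f b q + f b q') ->
  (forall a b : ore, b != 0 -> (odeg b <= odeg a)%N ->
     exists q, forall j, ((odeg a).-1 <= j)%N -> lcoef (val (a - f b q)) (Posz j) = 0) ->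
  forall a b, b != 0 -> exists q, (odeg (a - f b q)%R < odeg b)%N.
Proof.
move=> fD step a b b0; have [n] := ubnP (odeg a); elim: n a => // n IH a.
rewrite ltnS => an; have [ab|ba] := ltnP (odeg a) (odeg b).
  have f0 : f b 0 = 0.
    by apply: (@addrI _ (f b 0)); rewrite -fD !addr0.
  by exists 0; rewrite f0 subr0.
have [q /odeg_ltP qP] := step a b b0 ba.
have [|q' q'P] := IH (a - f b q).
  have a0 := leq_trans (odeg_gt0 b0) ba.
  by apply: leq_ltn_trans qP _; rewrite prednK.
by exists (q + q'); rewrite fD opprD addrA.
Qed.

Lemma ore_ldiv (a b : ore) : b != 0 -> exists q, (odeg (a - q * b)%R < odeg b)%N.
Proof.
move: a b; apply: (@ore_division (fun b q => q * b)) => [b q q'|a b b0 ba].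
  exact: mulrDl.
(* With this [c], the leading coefficient [c * sz k (olead b)] of the multiple of [b] equals that of
   [a]. *)
set k := (odeg a - odeg b)%N; pose c := olead a / sz k (olead b).
exists (omonom c k) => j ja.
rewrite val_oreB val_oreM [LHS]lcoefB [X in _ - X]lcoef_lmonomM //.
have := odeg_gt0 b0; move=> hb.
rewrite (_ : Posz j - Posz k = (j - k)%N); last by lia.
move: ja; rewrite leq_eqVlt => /orP[/eqP <-|ja].
  rewrite (_ : (_ - k)%N = (odeg b).-1); last by lia.
  rewrite -/(olead b) /c divfK ?subrr // siter_eq0 //; exact: olead_neq0.
rewrite (odeg_ltP a _ (leqnn _)); last by lia.
by rewrite (odeg_ltP b _ (leqnn _)) ?raddf0 ?mulr0 ?subr0 //; lia.
Qed.

Lemma ore_rdiv (a b : ore) : b != 0 -> exists q, (odeg (a - b * q)%R < odeg b)%N.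
Proof.
move: a b; apply: (@ore_division (fun b q => b * q)) => [b q q'|a b b0 ba].
  exact: mulrDr.
set k := (odeg a - odeg b)%N.
(* On the right, [c] is twisted by the order of [b]: the leading coefficient is [olead b] times
   [sz (odeg b).-1 c]. Solving for [c] requires a negative power of the automorphism. *)
pose c := sz (- Posz (odeg b).-1) (olead a / olead b).
exists (omonom c k) => j ja.
rewrite val_oreB val_oreM [LHS]lcoefB [X in _ - X]lcoefM_lmonom //.
have := odeg_gt0 b0; move=> hb.
rewrite (_ : Posz j - Posz k = (j - k)%N); last by lia.
move: ja; rewrite leq_eqVlt => /orP[/eqP <-|ja].
  rewrite (_ : (_ - k)%N = (odeg b).-1); last by lia.
  rewrite -/(olead b) siterNK // mulrC divfK ?subrr //; exact: olead_neq0.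
rewrite (odeg_ltP a _ (leqnn _)); last by lia.
by rewrite (odeg_ltP b _ (leqnn _)) ?mul0r ?subr0 //; lia.
Qed.

(** * Operator matrices as matrices over a ring, and their action on vectors *)

Lemma lmulmxE m n p (A : 'M[L]_(m, n)) (B : 'M[L]_(n, p)) :
  lmulmx s si A B = A *m B.
Proof. by apply/matrixP=> i j; rewrite !mxE. Qed.

Lemma lidmxE n : lidmx K n = 1%:M :> 'M[L]_n.
Proof. by apply/matrixP=> i j; rewrite !mxE; case: eqP. Qed.

Lemma lactmxM m n p (A : 'M[L]_(m, n)) (B : 'M[L]_(n, p)) y :
  lactmx s si (A *m B) y = lactmx s si A (lactmx s si B y).
Proof.
apply/matrixP=> i k; rewrite !mxE.
under [RHS]eq_bigr do rewrite mxE (raddf_sum (lact s si _)).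
rewrite exchange_big /=; apply: eq_bigr => j _; rewrite mxE.
rewrite (big_morph (fun a : L => lact s si a (y j 0)) (id1 := 0) (op1 := +%R)).
- by apply: eq_bigr => l _; apply: lactM.
- by move=> a b; apply: lactD.
- by rewrite /lact /= !size_poly0 !big_ord0 addr0.
Qed.

Lemma lactmx1 n (y : 'cV[K]_n) : lactmx s si (1%:M : 'M[L]_n) y = y.
Proof.
apply/matrixP=> i k; rewrite !mxE (bigD1 i) //= big1 => [|j ji].
  by rewrite addr0 mxE eqxx (ord1 k) [LHS]lact1.
by rewrite mxE eq_sym (negPf ji) /lact /= !size_poly0 !big_ord0 addr0.
Qed.

End Ore.

Arguments lmulmxE [K s si] sK siK [m n p] A B.
Arguments lidmxE [K s si] sK siK n.
Arguments lactmxM [K s si] sK siK [m n p] A B y.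
Arguments lactmx1 [K s si] sK siK [n] y.

(** * Diagonal systems *)

Section Decomposition.
Variables (K : fieldType) (s : {rmorphism K -> K}) (si : K -> K).
Hypotheses (sK : cancel s si) (siK : cancel si s).

Local Notation sz := (siter s si).
Local Notation L := (lring sK siK).
Local Notation ore := (ore sK siK).
Local Notation omonom := (omonom sK siK).
Local Notation shift e := (lmonom 1 e : L).
Local Notation toL := (map_mx (val : ore -> L)).

Lemma shiftD x y : shift x * shift y = shift (x + y).
Proof. by apply: etrans (lmonomM sK siK _ _ _ _) _; rewrite siter_1 // mulr1. Qed.

(** Left multiplication by a power of sigma moves all coefficients up and applies an injective map
    to them, so the leading one survives. *)
Lemma odeg_shiftM k (d : ore) : d != 0 ->
  odeg (omonom 1 k * d) = (k + odeg d)%N.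
Proof.
move=> d0; have dgt := odeg_gt0 d0; have ld := olead_neq0 d0.
have E j : lcoef (val (omonom 1 k * d)) (Posz j) = sz k (lcoef (val d) (Posz j - Posz k)).
  by rewrite val_oreM [LHS]lcoef_lmonomM // mul1r.
apply/eqP; rewrite eqn_leq; apply/andP; split.
  apply/odeg_ltP => j kj; rewrite E (_ : Posz j - Posz k = (j - k)%N); last by lia.
  by rewrite (odeg_ltP _ _ (leqnn _)) ?raddf0 //; lia.
rewrite leqNgt; apply/negP; rewrite -(prednK dgt) addnS ltnS.
move=> /odeg_ltP/(_ _ (leqnn _))/eqP; rewrite E.
rewrite (_ : Posz _ - Posz k = (odeg d).-1); last by lia.
by rewrite siter_eq0 // (negPf ld).
Qed.

Definition shift_mx n (e : nat -> int) : 'M[L]_n := diag_mx (\row_i shift (e i)).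

Lemma shift_mxM n e f : (forall i, e i + f i = 0) ->
  shift_mx n e *m shift_mx n f = 1%:M.
Proof.
move=> ef0; rewrite mulmx_diag -diag_const_mx; congr diag_mx; apply/matrixP=> i j.
by rewrite !mxE shiftD ef0; apply: (esym (lone_lmonom K)).
Qed.

(** Coefficients restricted by [is_ore] are the same as elements of the subring [ore], so the rank
    results for abstract rings apply to [rows_indep]. *)
Lemma rows_indepE m n (A0 : 'M[ore]_(m, n)) (S : {set 'I_m}) :
  rows_indep s si (toL A0) S <-> left_indep A0 S.
Proof.
split=> indS.
- move=> u uA i iS; apply: val_inj.
  apply: (indS (fun i => val (u i)) _ _ i iS) => [k|j]; first exact: (valP (u k)).
  rewrite -[RHS](congr1 val (uA j)) [RHS](rmorph_sum (val : ore -> L)).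
  by apply: eq_bigr => k _; rewrite mxE; apply/esym/val_oreM.
- move=> u ore_u uA i iS.
  pose u0 k : ore := mk_ore sK siK (ore_u k).
  apply: (congr1 val (indS u0 _ i iS)) => j; apply: val_inj.
  rewrite (rmorph_sum (val : ore -> L)) -[RHS](uA j).
  by apply: eq_bigr => k _; rewrite mxE; apply: val_oreM.
Qed.

(** After diagonalization over the Ore ring, row [i] is multiplied by the power of sigma that its
    entry lacks to reach the maximal order [l]. The inverse of this scaling has negative powers, so
    only the row transformation leaves the Ore ring. *)
Lemma ore_diagonalize m n (A : 'M[lop K]_(m, n)) : ore_mx A ->
  exists (r : nat) (P P' : 'M[lop K]_m) (Q Q' : 'M[lop K]_n) (a : nat -> lop K) (l : nat),
  [/\ (r <= m)%N, (r <= n)%N, ore_rank s si A r,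
      lunimod s si P P' /\ ore_unimod s si Q Q'
    & [/\ forall i, is_ore (a i), forall i, (i < r)%N -> size (a i).2 = l.+1
        & lmulmx s si (lmulmx s si P A) Q =
          \matrix_(i, j) if (i == j :> nat) && (i < r)%N then a i else 0]].
Proof.
move=> oreA.
pose A0 : 'M[ore]_(m, n) :=
  \matrix_(i, j) mk_ore sK siK (oreA i j).
have -> : A = toL A0 by apply/matrixP=> i j; rewrite !mxE.
have [r [d [rm rn d0 eA]]] := diagonalize (@ore_ldiv _ _ _ sK siK)
  (@ore_rdiv _ _ _ sK siK) A0.
have [P [P' [Q [Q' [PP' P'P QQ' Q'Q E]]]]] := eA.
(* The largest order of a diagonal entry; for [r = 0] the maximum is [0] and so is [l]. *)
pose l := (\max_(i < r) odeg (d i)).-1.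
have dl i : (i < r)%N -> (odeg (d i) <= l.+1)%N.
  move=> ir; have le := @leq_bigmax _ (fun i : 'I_r => odeg (d i)) (Ordinal ir).
  by rewrite /l prednK // (leq_trans _ le) // odeg_gt0 ?d0.
(* The subtraction is exact for [i < r] by [dl]; the remaining rows of the diagonal form are zero,
   so any exponent suits them. *)
pose e i := (l.+1 - odeg (d i))%N.
pose T := shift_mx m (fun i => Posz (e i)).
pose T' := shift_mx m (fun i => - Posz (e i)).
have TT' : T *m T' = 1%:M by apply: shift_mxM => i; rewrite subrr.
have T'T : T' *m T = 1%:M by apply: shift_mxM => i; rewrite addNr.
exists r, (T *m toL P), (toL P' *m T'), (toL Q), (toL Q').
exists (fun i => val (omonom 1 (e i) * d i)), l; split=> //.
- split; last first.
    move=> S /rows_indepE.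
    exact: (left_indep_card (@ore_ldiv _ _ _ sK siK) (@ore_rdiv _ _ _ sK siK) rm eA).
  have [S Sr indS] := left_indep_exists (@ore_mulf_eq0 _ _ _ sK siK)
    (@ore_ldiv _ _ _ sK siK) (@ore_rdiv _ _ _ sK siK) rm rn d0 eA.
  by exists S => //; apply/rows_indepE.
- split; split; rewrite ?(lmulmxE sK siK) ?(lidmxE sK siK).
  + by rewrite mulmxA -(mulmxA T) -map_mxM PP' map_mx1 mulmx1 TT'.
  + by rewrite mulmxA -(mulmxA (toL P')) T'T mulmx1 -map_mxM P'P map_mx1.
  + by move=> i j; rewrite mxE; apply: (valP (Q i j)).
  + by move=> i j; rewrite mxE; apply: (valP (Q' i j)).
  + by split; rewrite (lmulmxE sK siK) -map_mxM (QQ', Q'Q) map_mx1 (lidmxE sK siK).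
- split=> [i|i ir|]; first exact: (valP (omonom 1 (e i) * d i)).
    by rewrite -/(odeg _) odeg_shiftM ?d0 // subnK ?dl.
  rewrite !(lmulmxE sK siK) -!(mulmxA T) -!map_mxM -E mul_diag_mx.
  apply/matrixP=> i j; rewrite !mxE; case: ifP => _; last exact: (mulr0 (shift (e i))).
  by rewrite val_oreM.
Qed.

Definition diag_lop r (a : nat -> lop K) : 'M[lop K]_r :=
  \matrix_(i, j) if i == j then a i else 0.

Lemma det_coefmx_diag r a z :
  \det (coefmx (diag_lop r a) z) = \prod_(i < r) lcoef (a i) z.
Proof.
rewrite (_ : coefmx _ z = diag_mx (\row_i lcoef (a i) z)).
  by rewrite det_diag; apply: eq_bigr => i _; rewrite mxE.
by apply/matrixP=> i j; rewrite !mxE; case: eqP => // _; rewrite lcoef0.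
Qed.

(** Equal orders make the coefficient matrix at [l] diagonal with nonzero entries. For the tail,
    each row is shifted down until its lowest nonzero coefficient becomes the constant one. *)
Lemma fully_regular_diag r (a : nat -> lop K) l :
  (forall i, (i < r)%N -> is_ore (a i)) ->
  (forall i, (i < r)%N -> size (a i).2 = l.+1) ->
  fully_regular s si (diag_lop r a).
Proof.
move=> ore_a size_a.
have lead i : (i < r)%N -> lcoef (a i) l != 0.
  move=> ir; have -> : lcoef (a i) l = lead_coef (a i).2 by rewrite /lead_coef size_a.
  by rewrite lead_coef_eq0 -size_poly_eq0 size_a.
split.
  rewrite /head_regular det_coefmx_diag; apply/prodf_neq0 => i _.
  suff -> : lorder (diag_lop r a) = l by exact: lead.
  apply/eqP; rewrite eqn_leq; apply/andP; split.
    apply/bigmax_leqP => j _; apply/bigmax_leqP => k _; rewrite mxE.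
    by case: eqP => _; rewrite ?size_a ?size_poly0.
  apply: leq_trans (leq_bigmax i); apply: leq_trans (leq_bigmax i).
  by rewrite mxE eqxx size_a.
(* The index of the lowest nonzero coefficient of [a i]. *)
pose v i := find (fun c => c != 0) (a i).2.
have hasv i : (i < r)%N -> has (fun c => c != 0) (a i).2.
  move=> ir; apply/(has_nthP 0); exists l; first by rewrite size_a.
  exact: lead.
pose W := shift_mx r (fun i => - Posz (v i)).
have WE i j z : lcoef (lmulmx s si W (diag_lop r a) i j) z =
    if i == j then sz (- Posz (v i)) (lcoef (a i) (z + v i)) else 0.
  rewrite (lmulmxE sK siK) mul_diag_mx !mxE [LHS]lcoef_lmonomM // mul1r opprK.
  by case: eqP => // _; rewrite lcoef0 raddf0.
exists W, (shift_mx r (fun i => Posz (v i))); split.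
- split; rewrite (lmulmxE sK siK) (lidmxE sK siK); apply: shift_mxM => i.
    by rewrite addNr.
  by rewrite subrr.
- move=> i j; apply/is_oreP => k; rewrite WE; case: eqP => // _.
  (* The coefficient at [-(k+1)] after the shift comes from index [v i - k - 1] of [a i]: either it
     lies below the first nonzero one, or the index is negative and [a i] has no such term. *)
  have [kv|vk] := ltnP k (v i).
    rewrite (_ : Negz k + v i = (v i - k.+1)%N); last by lia.
    have lt : (v i - k.+1 < v i)%N by lia.
    rewrite (_ : lcoef _ _ = 0) ?siter_0 //; apply/eqP/negbFE.
    exact: (before_find 0 lt).
  rewrite (_ : Negz k + v i = Negz (k - v i)); last by lia.
  by rewrite (is_oreP _ (ore_a i _)) ?siter_0.
- rewrite /tail_regular (_ : coefmx _ 0 =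
    diag_mx (\row_i sz (- Posz (v i)) (lcoef (a i) (v i)))).
    rewrite det_diag; apply/prodf_neq0 => i _; rewrite mxE siter_eq0 //.
    exact: (nth_find 0 (hasv i (ltn_ord i))).
  apply/matrixP=> i j; rewrite mxE WE !mxE add0r.
  by case: eqP.
Qed.

End Decomposition.

(** * Clearing denominators, and cutting vectors at the rank *)

Lemma common_denominator (F : fieldType) (xs : seq (ratf F)) :
  exists2 c : {poly F}, c != 0 & forall x, x \in xs -> is_polyF (c%:F * x).
Proof.
elim: xs => [|x xs [c c0 IH]]; first by exists 1; rewrite ?oner_eq0.
have [d d0 [n dx]] : exists2 d : {poly F}, d != 0 & is_polyF (d%:F * x).
  (* For a representing pair [x], its second component serves as denominator and the first is what
     remains. *)
  elim/quotW: x => x; exists x.2; rewrite ?denom_ratioP //; exists x.1.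
  unlock FracField.tofrac; rewrite -[LHS]FracField.pi_mul; apply/eqmodP.
  rewrite /= FracField.equivfE /FracField.mulf !numden_Ratio
    ?mulf_neq0 ?oner_eq0 ?denom_ratioP //.
  by rewrite mulr1 mul1r mulrC.
exists (c * d); first by rewrite mulf_neq0.
move=> y; rewrite inE => /orP[/eqP->|/IH[p pE]].
  by exists (c * n); rewrite !rmorphM -mulrA dx.
by exists (d * p); rewrite !rmorphM mulrAC mulrC pE.
Qed.

Lemma topvE (K : Type) r m (h : (r <= m)%N) (v : 'cV[K]_m) i :
  topv h v i 0 = v (widen_ord h i) 0.
Proof. by rewrite mxE castmxE; congr (v _ _); apply: val_inj. Qed.

Lemma botv_eq0 (K : fieldType) r m (h : (r <= m)%N) (v : 'cV[K]_m) :
  botv h v = 0 <-> forall i : 'I_m, (r <= i)%N -> v i 0 = 0.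
Proof.
split=> [/matrixP v0 i ri|v0].
  have ltir : (i - r < m - r)%N by rewrite ltn_sub2r // (leq_ltn_trans ri).
  have := v0 (Ordinal ltir) 0; rewrite !mxE castmxE => <-.
  by congr (v _ _); apply: val_inj; rewrite /= ?subnKC.
apply/matrixP=> i j; rewrite !mxE castmxE (ord1 j)
  -[RHS](v0 (cast_ord (subnKC h) (rshift r i))).
  by congr (v _ _); apply: val_inj.
by rewrite /= leq_addr.
Qed.

(** * Block form and solutions of a diagonal system *)

Section Solutions.
Variables (K : fieldType) (s : {rmorphism K -> K}) (si : K -> K).
Hypotheses (sK : cancel s si) (siK : cancel si s).

Lemma lact0l x : lact s si 0 x = 0.
Proof. by rewrite /lact !size_poly0 !big_ord0 addr0. Qed.

Lemma diag_lop_castmx r m n (a : nat -> lop K) (hm : (r <= m)%N) (hn : (r <= n)%N) :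
  \matrix_(i < m, j < n) (if (i == j :> nat) && (i < r)%N then a i else 0) =
  castmx (subnKC hm, subnKC hn)
    (block_mx (diag_lop r a) (lzeromx K r (n - r)) (lzeromx K (m - r) r)
              (lzeromx K (m - r) (n - r))).
Proof.
apply/matrixP=> i j; rewrite mxE castmxE /=.
set i' := cast_ord _ i; set j' := cast_ord _ j.
rewrite -[nat_of_ord i]/(nat_of_ord i') -[nat_of_ord j]/(nat_of_ord j').
case: (split_ordP i') => {i'}i ->; case: (split_ordP j') => {j'}j ->.
- by rewrite block_mxEul mxE andbT.
- rewrite block_mxEur mxE /=; case: eqP => //= ij.
  by have := ltn_ord i; rewrite ij ltnNge leq_addr.
- by rewrite block_mxEdl mxE andbF.
- by rewrite block_mxEdr mxE andbF.
Qed.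

(** Rows from index [r] on are zero and only impose the compatibility condition on [w]; the others
    involve just the first [r] coordinates of [z], so the rest of [z] is free. *)
Lemma lactmx_diag_block r m n (a : nat -> lop K) (hm : (r <= m)%N) (hn : (r <= n)%N)
    (z : 'cV[K]_n) (w : 'cV[K]_m) :
  lactmx s si (\matrix_(i, j) (if (i == j :> nat) && (i < r)%N then a i else 0)) z = w <->
  botv hm w = 0 /\ lactmx s si (diag_lop r a) (topv hn z) = topv hm w.
Proof.
set D := \matrix_(i, j) _.
have Dge (i : 'I_m) : (r <= i)%N -> lactmx s si D z i 0 = 0.
  move=> ri; rewrite mxE big1 // => j _.
  by rewrite mxE ltnNge ri andbF lact0l.
have Dlt (i : 'I_r) : lactmx s si D z (widen_ord hm i) 0 =
    lactmx s si (diag_lop r a) (topv hn z) i 0.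
  rewrite !mxE (bigD1 (widen_ord hn i)) //= big1 => [|j ji]; last first.
    rewrite mxE /=; case: eqP => [ij|]; rewrite ?lact0l //.
    by case/eqP: ji; apply: val_inj.
  rewrite [in RHS](bigD1 i) //= big1 => [|j ji]; last first.
    by rewrite mxE eq_sym (negPf ji) lact0l.
  by rewrite !mxE /= !eqxx ltn_ord /= -topvE mxE.
rewrite botv_eq0; split=> [<-|[w0 wE]].
  by split=> //; apply/matrixP=> i j; rewrite (ord1 j) topvE Dlt.
apply/matrixP=> i j; rewrite (ord1 j); have [ir|ri] := ltnP i r; last first.
  by rewrite w0 ?Dge.
have -> : i = widen_ord hm (Ordinal ir) by apply: val_inj.
by rewrite Dlt wE topvE.
Qed.

Lemma lcoef_lscale c (x : lop K) z : lcoef (lscale c x) z = c * lcoef x z.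
Proof. by case: z => k /=; rewrite coefZ. Qed.

End Solutions.

Theorem theorem5 (F : fieldType) (sF : {rmorphism F -> F}) (sFi : F -> F)
  (s : {rmorphism ratf F -> ratf F}) (si : ratf F -> ratf F)
  (m n : nat) (A : 'M[lop (ratf F)]_(m, n)) (b : 'cV[ratf F]_m) :
  [pchar F] =i pred0 ->
  cancel sF sFi -> cancel sFi sF ->
  PiSigma sF s -> cancel s si -> cancel si s ->
  ore_mx A ->
  exists r : nat, exists (hm : (r <= m)%N) (hn : (r <= n)%N),
  exists (P P' : 'M[lop (ratf F)]_m) (Q Q' : 'M[lop (ratf F)]_n)
         (Ahat : 'M[lop (ratf F)]_r),
  [/\ ore_rank s si A r,
      lunimod s si P P' /\ ore_unimod s si Q Q',
      ore_mx Ahat /\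
      lmulmx s si (lmulmx s si P A) Q
        = castmx (subnKC hm, subnKC hn)
            (block_mx Ahat (lzeromx (ratf F) r (n - r)) (lzeromx (ratf F) (m - r) r)
                           (lzeromx (ratf F) (m - r) (n - r))),
      (* (i) *)
      (forall y : 'cV[ratf F]_n,
         lactmx s si A y = b <->
         (botv hm (lactmx s si P b) = 0 /\
          lactmx s si Ahat (topv hn (lactmx s si Q' y)) = topv hm (lactmx s si P b)))
    & (* (ii) *)
      (exists2 c : {poly F}, c != 0 &
         [/\ forall i j (z : int), is_polyF (lcoef (lscalemx c%:F Ahat i j) z),
             forall i, is_polyF (c%:F * topv hm (lactmx s si P b) i 0)
           & fully_regular s si (lscalemx c%:F Ahat)])].
Proof.
move=> _ _ _ _ sK siK oreA.
have [r [P [P' [Q [Q' [a [l [hm hn rk [uP uQ] [ore_a size_a PAQ]]]]]]]]] :=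
  ore_diagonalize sK siK oreA.
exists r, hm, hn, P, P', Q, Q', (diag_lop r a).
split=> //; first split.
- by move=> i j; rewrite mxE; case: eqP => // _; apply: eqxx.
- by rewrite PAQ diag_lop_castmx.
(* By [Q Q' = 1], the diagonal form acts on [Q' y] as [P A] does on [y]; applying [P'] then turns
   [P A y = P b] back into [A y = b]. *)
- move=> y; rewrite -lactmx_diag_block -PAQ !(lmulmxE sK siK).
  have [_ P'P] := uP; have [_ _ [QQ' _]] := uQ.
  rewrite !(lmulmxE sK siK) !(lidmxE sK siK) in P'P QQ'.
  rewrite -(lactmxM sK siK) -mulmxA QQ' mulmx1 (lactmxM sK siK).
  split=> [->//|PAy].
  by rewrite -[LHS](lactmx1 sK siK) -P'P (lactmxM sK siK) PAy -(lactmxM sK siK) P'P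
    (lactmx1 sK siK).
- pose w := topv hm (lactmx s si P b).
  (* The list joins the coefficients of the diagonal entries with the entries of the right-hand
     side, so one [c] clears both. *)
  have [c c0 cP] := common_denominator
    (flatten [seq (a (i : 'I_r)).2 : seq _ | i <- enum 'I_r] ++
     [seq w i 0 | i <- enum 'I_r]).
  have cF0 : c%:F != 0 by rewrite tofrac_eq0.
  have poly0 : is_polyF (0 : ratf F) by exists 0; rewrite tofrac0.
  have cAhat : lscalemx c%:F (diag_lop r a) = diag_lop r (fun i => lscale c%:F (a i)).
    apply/matrixP=> i j; rewrite !mxE; case: eqP => // _.
    by apply: lcoefP => z; rewrite lcoef_lscale lcoef0 mulr0.
  exists c; [exact: c0 | split].
  + move=> i j z; rewrite cAhat mxE; case: eqP => _; last by rewrite lcoef0.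
    rewrite lcoef_lscale; case: z => k; last first.
      by rewrite (is_oreP _ (ore_a i)) mulr0.
    have [ka|ka] := ltnP k (size (a i).2); last by rewrite lcoef_pos_ge // mulr0.
    apply: cP; rewrite mem_cat; apply/orP; left; apply/flatten_mapP.
    by exists i; rewrite ?mem_enum ?mem_nth.
  + move=> i; apply: cP; rewrite mem_cat; apply/orP; right.
    by apply/mapP; exists i; rewrite ?mem_enum.
  (* Scaling by the nonzero [c] preserves the diagonal shape and the common order. *)
  + rewrite cAhat; apply: (fully_regular_diag sK siK) => i ir.
      by have /eqP a1 := ore_a i; rewrite /is_ore /= a1 scaler0.
    by rewrite size_scale // size_a.
Qed.
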